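(* Let $T>0$, $0<\alpha<1$, let $B(\alpha)$ be a nonzero real number, and let $f\in AC[0,T]$. Define the Atangana--Baleanu (AB) integral of $f$ by $${}^{AB}\!J_0^{\alpha} f(t) = \frac{1-\alpha}{B(\alpha)} f(t) + \frac{\alpha}{B(\alpha)\Gamma(\alpha)}\int_0^t (t-\tau)^{\alpha-1} f(\tau)\,d\tau,$$ and, for $h\in AC[0,T]$, the Atangana--Baleanu (ABC) derivative of $h$ by $${}^{ABC}\!D_0^{\alpha} h(t) = \frac{B(\alpha)}{1-\alpha}\int_0^t E_\alpha\Bigl(-\frac{\alpha}{1-\alpha}(t-\tau)^{\alpha}\Bigr) h'(\tau)\,d\tau.$$ Then, for $0<t\le T$, $${}^{ABC}\!D_0^{\alpha}\bigl[{}^{AB}\!J_0^{\alpha} f\bigr](t) = f(t) - E_\alpha\Bigl(-\frac{\alpha}{1-\alpha}t^{\alpha}\Bigr) f(0).$$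
   Context: $E_\alpha(z)=\sum_{k=0}^{\infty} \frac{z^k}{\Gamma(\alpha k+1)}$ is the Mittag-Leffler function and $\Gamma$ is the Euler Gamma function. $AC[0,T]$ is the space of absolutely continuous functions on $[0,T]$: $f\in AC[0,T]$ if and only if $f(t)=f(0)+\int_0^t f'(s)\,ds$ for $0\le t\le T$ with some $f'\in L^1[0,T]$. $B(\alpha)$ is a normalization factor, regarded as a function of $\alpha$ with $B(0)=B(1)=1$. *)

(* Defs.v *)
From HB Require Import structures.
From mathcomp Require Import all_boot all_order all_algebra.
From mathcomp Require Import all_classical all_reals all_analysis.
Import Order.TTheory GRing.Theory Num.Theory.
Import numFieldNormedType.Exports.

Set Implicit Arguments.
Unset Strict Implicit.
Unset Printing Implicit Defensive.

Local Open Scope classical_set_scope.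
Local Open Scope ring_scope.

Section Defs.
Context {R : realType}.
Implicit Types (T alpha s z t : R) (B f g h : R -> R).
Local Notation mu := (@lebesgue_measure R).

(* Euler's integral; only used for s > 0, where it converges. *)
Definition Gamma s : R :=
  \int[mu]_(x in `]0, +oo[) (x `^ (s - 1) * expR (- x)).

Definition mittag_leffler alpha z : R :=
  limn [series z ^+ k / Gamma (alpha * k%:R + 1)]_k.

Definition is_L1_derivative T h g : Prop :=
  mu.-integrable `[0, T] (EFin \o g) /\
  forall t, 0 <= t <= T -> h t = h 0 + \int[mu]_(s in `[0, t]) g s.

Definition abs_continuous T h : Prop := exists g, is_L1_derivative T h g.

(* For h absolutely continuous on [0, T] the L^1 derivative is determined up to
   equality almost everywhere on [0, T]; this picks a representative. The
   default value is irrelevant: it is taken only if h is not absolutely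
   continuous. *)
Definition L1_derivative T h : R -> R :=
  xget (fun=> 0) [set g | is_L1_derivative T h g].

Definition AB_integral B alpha f t : R :=
  (1 - alpha) / B alpha * f t
  + alpha / (B alpha * Gamma alpha) *
    \int[mu]_(s in `[0, t]) ((t - s) `^ (alpha - 1) * f s).

(* The horizon T enters only through the representative of the derivative of
   h on [0, T]; t is meant to lie in [0, T]. *)
Definition ABC_derivative T B alpha h t : R :=
  B alpha / (1 - alpha) *
  \int[mu]_(s in `[0, t])
    (mittag_leffler alpha (- (alpha / (1 - alpha)) * (t - s) `^ alpha)
     * L1_derivative T h s).

End Defs.

(* Main.v *)
(* Write [k_a x = x^(a-1) / Gamma a] for [x > 0] and 0 elsewhere, and [I^a] for
   convolution with [k_a]. The Euler beta integral gives [k_a * k_b = k_(a+b)],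
   hence [I^a I^b = I^(a+b)]. With [f = f 0 + I^1 g],
   [lam = alpha / (1 - alpha)] and [c = (1 - alpha) / B alpha], the AB integral
   of [f] is [h = c (f + lam I^alpha f)], which is [c (f 0)] plus the primitive
   of [c (g + lam (f 0 k_alpha + I^alpha g))]. For any L^1 derivative [G] of [h],
   expanding the Mittag-Leffler kernel turns the ABC derivative into
   [1 / c * \sum_k (- lam)^k I^(alpha k + 1) G], where
   [I^(alpha k + 1) G = I^(alpha k) (h - h 0)] by the semigroup law. Inserting
   the formula for [h] makes the sum telescope; what remains is [f] minus
   [f 0] times the Mittag-Leffler series, and a term that tends to 0. *)
Require Import Defs.
From HB Require Import structures.
From mathcomp Require Import all_boot all_order all_algebra.
From mathcomp Require Import all_classical all_reals all_analysis.
From mathcomp Require Import ring lra measurable_realfun.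
Import Order.TTheory GRing.Theory Num.Theory.
Import numFieldNormedType.Exports.
Local Open Scope classical_set_scope.
Local Open Scope ring_scope.

Set Implicit Arguments.
Unset Strict Implicit.
Unset Printing Implicit Defensive.

(** * Affine change of variables for Lebesgue integrals *)

Section AffineChange.
Context {R : realType}.
Local Notation mu := (@lebesgue_measure R).

Let affine (c d : R) (u : R) : measurableTypeR R := c * u + d.

Let measurable_affine c d : measurable_fun [set: R] (affine c d).
Proof. by apply: measurable_funD => //; exact: measurable_funM. Qed.

(** Uniqueness of Lebesgue measure reduces this to half-open intervals, whose preimages under the
    affine map are half-open intervals with length divided by [c]. *)
Lemma lebesgue_measure_affine (c d : R) (c0 : 0 < c) (A : set R) :
  measurable A ->
  mu A = (c%:E * pushforward mu (affine c d) A)%E.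
Proof.
move=> mA.
have := @lebesgue_measure_unique R
  (mscale (NngNum (ltW c0)) (pushforward mu (affine c d))) => /=.
apply => //; first exact: measurable_affine.
move=> /= mphi X [[a b] _ <-].
rewrite /= /mscale /=.
have -> : pushforward mu (affine c d) `]a, b] = mu `](a - d) / c, (b - d) / c].
  congr (lebesgue_measure _); apply/seteqP; split => u /=; rewrite !in_itv /=
    /affine ltr_pdivrMr// ler_pdivlMr// ltrBlDr lerBrDr [u * c]mulrC //.
rewrite !lebesgue_measure_itv /= !lte_fin.
rewrite ltr_pM2r ?invr_gt0// ltrD2r.
case: ifPn => _; last by rewrite mule0.
by rewrite -!EFinD -EFinM; congr EFin; field; rewrite gt_eqF.
Qed.

Lemma ge0_integral_affine (c d : R) (f : R -> \bar R) : 0 < c ->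
  measurable_fun setT f -> (forall x, 0 <= f x)%E ->
  (\int[mu]_x f x = c%:E * \int[mu]_x f (c * x + d)%R)%E.
Proof.
move=> c0 mf f0.
rewrite (eq_measure_integral
  (mscale (NngNum (ltW c0)) (pushforward mu (affine c d)))); last first.
  by move=> mphi A mA _; exact: lebesgue_measure_affine.
2: exact: measurable_affine.
move=> mphi.
rewrite ge0_integral_mscale// ge0_integral_pushforward//.
Qed.

Lemma ge0_integral_shift (d : R) (f : R -> \bar R) :
  measurable_fun setT f -> (forall x, 0 <= f x)%E ->
  (\int[mu]_x f (x - d)%R = \int[mu]_x f x)%E.
Proof.
move=> mf f0; rewrite [RHS](@ge0_integral_affine 1 (- d))// mul1e.
by apply: eq_integral => x _; rewrite mul1r.
Qed.

End AffineChange.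

(** * Power kernels and basic estimates for the Gamma function *)

Section PowerKernel.
Context {R : realType}.
Local Notation mu := (@lebesgue_measure R).
Implicit Types a b x y : R.

Lemma integral_powR_itv a y : 0 < a -> 0 < y < 1 ->
  (\int[mu]_(x in `[y, 1%R]) (x `^ (a - 1))%:E = (a^-1 - a^-1 * y `^ a)%:E)%E.
Proof.
move=> a0 /andP[y0 y1].
have pos x : x \in `[y, 1] -> x \in `]0, +oo[.
  by rewrite !in_itv /= andbT => /andP[+ _]; exact: lt_le_trans.
have cF x : x \in `[y, 1] -> {for x, continuous (fun x => a^-1 * x `^ a)}.
  move=> /pos xy; apply/differentiable_continuous/derivable1_diffP.
  by apply: derivableZ; exact: derivable_powR.
rewrite (@continuous_FTC2 R _ (fun x => a^-1 * x `^ a))//.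
- by rewrite powR1 mulr1 EFinB.
- apply: derivable_within_continuous => x /pos; exact: derivable_powR.
- split.
  + move=> x xy; apply: derivableZ; apply: derivable_powR; apply: pos.
    exact: subset_itv_oo_cc.
  + by apply: cvg_at_right_filter; apply: cF; rewrite in_itv/= lexx ltW.
  + by apply: cvg_at_left_filter; apply: cF; rewrite in_itv/= lexx ltW.
- move=> x /subset_itv_oo_cc/pos x0.
  rewrite derive1Ml; last exact: derivable_powR.
  by rewrite powR_derive1// mulKf// gt_eqF.
Qed.

(** Monotone convergence along closed intervals exhausting []0, 1]]: on each of them the
    antiderivative x^a / a gives at most 1 / a. *)
Lemma integral_powR01_lty a : 0 < a ->
  (\int[mu]_(x in `]0%R, 1%R]) (x `^ (a - 1))%:E < +oo)%E.
Proof.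
move=> a0.
(* Starting at [n.+2] keeps the left end strictly below 1, as [integral_powR_itv] demands. *)
pose F (n : nat) : set R := `[(n.+2%:R)^-1, 1]%classic.
have FE : `]0, 1]%classic = \bigcup_n F n.
  apply/seteqP; split=> x /=.
    rewrite in_itv/= => /andP[x0 x1].
    have [n nx] := ltr_add_invr x0.
    exists n => //=; rewrite /F/= in_itv/= x1 andbT.
    rewrite add0r in nx; apply: le_trans (ltW nx).
    by rewrite lef_pV2 ?posrE// ler_nat.
  move=> [n _]; rewrite /F/= !in_itv/= => /andP[+ ->]; rewrite andbT.
  by apply: lt_le_trans; rewrite invr_gt0.
rewrite FE.
apply: (@le_lt_trans _ _ (a^-1)%:E); last by rewrite ltry.
have H : (\int[mu]_(x in F i) ((x `^ (a - 1))%:E) @[i --> \oo] -->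
   \int[mu]_(x in \bigcup_i F i) ((x `^ (a - 1))%:E))%E.
  apply: ge0_nondecreasing_set_cvg_integral.
  - move=> m n mn; rewrite subsetEset => x; rewrite /F/= !in_itv/= => /andP[+ ->].
    by rewrite andbT; apply: le_trans; rewrite lef_pV2 ?posrE// ler_nat.
  - by move=> i; exact: measurable_itv.
  - move=> i; apply/measurable_EFinP; apply: measurable_funTS.
    exact: measurable_powR.
  - by move=> i x _; rewrite lee_fin powR_ge0.
rewrite -(cvg_lim _ H)//; apply: lime_le; first by apply/cvg_ex; eexists; exact: H.
apply: nearW => n; rewrite integral_powR_itv//.
  by rewrite lee_fin gerBl mulr_ge0// ?powR_ge0// invr_ge0 ltW.
by rewrite invr_gt0 ltr0n/= invf_lt1// ltr1n.
Qed.

(* Vanishes at 0 for every [a], unlike [0 `^ (a - 1)], which is 1 at [a = 1]. *)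
Definition trunc_pow a x : R := if 0 < x then x `^ (a - 1) else 0.

Lemma trunc_pow_ge0 a x : 0 <= trunc_pow a x.
Proof. by rewrite /trunc_pow; case: ifPn => // _; exact: powR_ge0. Qed.

Lemma trunc_powE a x : 0 < x -> trunc_pow a x = x `^ (a - 1).
Proof. by rewrite /trunc_pow => ->. Qed.

Lemma trunc_pow_le0 a x : x <= 0 -> trunc_pow a x = 0.
Proof. by move=> x0; rewrite /trunc_pow ltNge x0. Qed.

Lemma measurable_trunc_pow a : measurable_fun setT (trunc_pow a).
Proof.
apply: measurable_fun_if => //; first exact: measurable_fun_ltr.
by apply: measurable_funTS; exact: measurable_powR.
Qed.

(** An integrable majorant. On []0, 1]] the exponential is at most 1. Beyond 1 it splits into two
    factors e^(-x/2): one absorbs x^(n+1) through a single term of the exponential series, the other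
    is twice the exponential density of rate 1/2, whence the constant. *)
Lemma trunc_pow_exp_le a x n : a - 1 <= n.+1%:R ->
  trunc_pow a x * expR (- x) <= ((fun x => x `^ (a - 1)) \_ `]0, 1]) x
    + (2 ^+ n.+2 * n.+1`!%:R) * exponential_pdf 2^-1 x.
Proof.
move=> an.
have C0 : 0 <= 2 ^+ n.+2 * n.+1`!%:R :> R by rewrite mulr_ge0// exprn_ge0.
have pdf0 : 0 <= exponential_pdf (2^-1 : R) x by exact: exponential_pdf_ge0.
have [x0|x0] := leP x 0.
  rewrite trunc_pow_le0// mul0r addr_ge0//.
    by rewrite patchE; case: ifP => // _; exact: powR_ge0.
  exact: mulr_ge0.
rewrite trunc_powE//; have [x1|x1] := leP x 1.
  rewrite patchE mem_set/=; last by rewrite in_itv/= x0 x1.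
  apply: ler_wpDr; first exact: mulr_ge0.
  by rewrite ler_piMr ?powR_ge0// expR_le1 oppr_le0 ltW.
rewrite patchE memNset ?add0r /=; last first.
  by rewrite in_itv/= x0/= leNgt x1.
rewrite exponential_pdfE; last exact: ltW.
have -> : - x = - 2^-1 * x + - (2^-1 * x) by lra.
rewrite expRD expRN mulrA ler_pdivrMr ?expR_gt0// !mulrA.
rewrite [leRHS]mulrAC ler_wpM2r ?expR_ge0//.
apply: (@le_trans _ _ (x ^+ n.+1)).
  by rewrite -powR_mulrn ?(ltW x0)// ler_powR// ltW.
have hx : 0 <= 2^-1 * x by rewrite mulr_ge0// ltW.
have hle : (2^-1 * x) ^+ n.+1 / n.+1`!%:R <= expR (2^-1 * x).
  by apply: le_trans (expR_ge1Dxn n hx); rewrite lerDr.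
have -> : x ^+ n.+1 = 2 ^+ n.+1 * (2^-1 * x) ^+ n.+1.
  by rewrite -exprMn mulrA divff ?mul1r// pnatr_eq0.
rewrite ler_pdivrMr ?ltr0n ?fact_gt0// in hle.
rewrite [2 ^+ n.+2]exprS.
have -> : 2 * 2 ^+ n.+1 * n.+1`!%:R * 2^-1 * expR (2^-1 * x) =
  2 ^+ n.+1 * (expR (2^-1 * x) * n.+1`!%:R) by field.
by rewrite ler_wpM2l// exprn_ge0.
Qed.

Lemma measurable_trunc_pow_exp a :
  measurable_fun setT (fun x => trunc_pow a x * expR (- x)).
Proof.
apply: measurable_funM; first exact: measurable_trunc_pow.
by apply: measurableT_comp.
Qed.

Lemma Gamma_integral_lty a : 0 < a ->
  (\int[mu]_x (trunc_pow a x * expR (- x))%:E < +oo)%E.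
Proof.
move=> a0.
pose n := Num.truncn a.
have an : a - 1 <= n.+1%:R.
  by rewrite lerBlDr (le_trans (ltW (truncnS_gt a)))// lerDl.
have mpw : measurable_fun setT ((fun x => x `^ (a - 1)) \_ `]0, 1]).
  apply/(measurable_restrictT _ _).1 => //; apply: measurable_funTS.
  exact: measurable_powR.
have mexp : measurable_fun setT
    (fun x : R => (2 ^+ n.+2 * n.+1`!%:R) * exponential_pdf 2^-1 x).
  by apply: measurable_funM => //; exact: measurable_exponential_pdf.
have C0 : 0 <= 2 ^+ n.+2 * n.+1`!%:R :> R by rewrite mulr_ge0// exprn_ge0.
apply: (@le_lt_trans _ _ (\int[mu]_x
    ((((fun x => x `^ (a - 1)) \_ `]0, 1]) x)%:E
    + ((2 ^+ n.+2 * n.+1`!%:R) * exponential_pdf 2^-1 x)%:E))%E).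
  apply: ge0_le_integral => //.
  - by move=> x _; rewrite lee_fin mulr_ge0 ?trunc_pow_ge0 ?expR_ge0.
  - by apply/measurable_EFinP; exact: measurable_trunc_pow_exp.
  - by apply: emeasurable_funD; exact/measurable_EFinP.
  - by move=> x _; rewrite -EFinD lee_fin trunc_pow_exp_le.
rewrite ge0_integralD//; last 4 first.
- move=> x _; rewrite lee_fin patchE; case: ifP => // _; exact: powR_ge0.
- exact/measurable_EFinP.
- by move=> x _; rewrite lee_fin mulr_ge0// exponential_pdf_ge0.
- exact/measurable_EFinP.
rewrite lte_add_pinfty//.
  have := integral_powR01_lty a0.
  rewrite [X in (X < _)%E]integral_mkcond.
  by under eq_integral do rewrite restrict_EFin.
under eq_integral do rewrite EFinM.
rewrite ge0_integralZl//; last 2 first.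
- by apply/measurable_EFinP; exact: measurable_exponential_pdf.
- by move=> x _; rewrite lee_fin exponential_pdf_ge0.
by rewrite integral_exponential_pdf// mule1 ltry.
Qed.

(** [Gamma] is [fine] of an extended integral; finiteness makes the two agree, so that Tonelli
    applies to products of Gamma values. *)
Lemma Gamma_integral a : 0 < a ->
  (\int[mu]_x (trunc_pow a x * expR (- x))%:E = (Gamma a)%:E)%E.
Proof.
move=> a0; rewrite /Gamma Rintegral_mkcond /Rintegral.
under [in RHS]eq_integral => x _.
  rewrite (_ : _ x = trunc_pow a x * expR (- x)); first over.
  rewrite patchE /trunc_pow.
  have [x0|x0] := ltP 0 x; first by rewrite mem_set//= in_itv/= x0.
  by rewrite memNset ?mul0r//= in_itv/= ltNge x0.
rewrite fineK// ge0_fin_numE; first exact: Gamma_integral_lty.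
by apply: integral_ge0 => x _; rewrite lee_fin mulr_ge0 ?trunc_pow_ge0 ?expR_ge0.
Qed.

Lemma Gamma1 : Gamma 1 = 1 :> R.
Proof.
apply: EFin_inj; rewrite -Gamma_integral// -(@integral_exponential_pdf R 1)//.
transitivity (\int[mu]_(x in `]0%R, +oo[) (expR (- x))%:E)%E.
  rewrite [RHS]integral_mkcond; apply: eq_integral => x _.
  rewrite patchE /trunc_pow; have [x0|x0] := ltP 0 x.
    by rewrite mem_set/= ?in_itv/= ?x0// subrr powRr0 mul1r.
  by rewrite memNset ?mul0r//= in_itv/= ltNge x0.
rewrite integral_itv_obnd_cbnd; last first.
  by apply/measurable_EFinP/measurableT_comp.
rewrite [LHS]integral_mkcond; apply: eq_integral => x _.
rewrite /exponential_pdf !patchE; case: ifP => // _.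
by rewrite mul1r mulN1r.
Qed.

(* Compares the integrand with the shifted density
   [r * expR (- r * (x - M))] of the exponential law. *)
Lemma Gamma_ge a (M r c : R) : 0 < a -> 0 < M -> 0 < r -> 0 <= c ->
  (forall x, M <= x -> c * expR (- r * (x - M)) <= x `^ (a - 1) * expR (- x)) ->
  c / r <= Gamma a.
Proof.
move=> a0 M0 r0 c0 cle.
have cr0 : 0 <= c / r by rewrite divr_ge0// ltW.
have mpdf : measurable_fun setT (fun x : R => exponential_pdf r (x - M)).
  apply: (measurableT_comp (measurable_exponential_pdf _)).
  exact: measurable_funB.
have pdf0 x : 0 <= exponential_pdf r x by rewrite exponential_pdf_ge0// ltW.
rewrite -lee_fin -Gamma_integral//.
have <- : (\int[mu]_x (c / r * exponential_pdf r (x - M))%:E = (c / r)%:E)%E.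
  under eq_integral do rewrite EFinM.
  rewrite ge0_integralZl//; last 2 first.
  - exact/measurable_EFinP.
  - by move=> x _; rewrite lee_fin.
  rewrite (@ge0_integral_shift R M (EFin \o exponential_pdf r))/=.
  - by rewrite integral_exponential_pdf// mule1.
  - by apply/measurable_EFinP; exact: measurable_exponential_pdf.
  - by move=> x; rewrite lee_fin.
apply: ge0_le_integral => //.
- by move=> x _; rewrite lee_fin mulr_ge0.
- by apply/measurable_EFinP; exact: measurable_funM.
- by apply/measurable_EFinP; exact: measurable_trunc_pow_exp.
move=> x _; rewrite lee_fin; have [xM|xM] := ltP (x - M) 0.
  by rewrite lt0_exponential_pdf// mulr0 mulr_ge0 ?trunc_pow_ge0 ?expR_ge0.
rewrite exponential_pdfE// mulrA divfK ?gt_eqF//.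
rewrite subr_ge0 in xM.
by rewrite trunc_powE ?(lt_le_trans M0)// cle.
Qed.

(** Rate 1 in [Gamma_ge], since x^p does not decrease beyond [M]. Leaving [M] free makes Gamma
    outgrow every geometric sequence. *)
Lemma Gamma_ge_powR (M p : R) : 0 < M -> 0 <= p ->
  M `^ p * expR (- M) <= Gamma (p + 1).
Proof.
move=> M0 p0; rewrite -[leLHS]divr1; apply: (@Gamma_ge (p + 1) M) => //.
- by rewrite ltr_wpDl.
- by rewrite mulr_ge0 ?powR_ge0 ?expR_ge0.
move=> x Mx; rewrite addrK -mulrA -expRD.
rewrite (_ : - M + _ = - x); last by ring.
by rewrite ler_wpM2r ?expR_ge0// ge0_ler_powR// ?nnegrE ?(le_trans _ Mx)// ltW.
Qed.

Lemma Gamma_gt0 a : 0 < a -> 0 < Gamma a :> R.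
Proof.
move=> a0; have [a1|a1] := leP 1 a.
  have := @Gamma_ge_powR 1 (a - 1) ltr01; rewrite subrK subr_ge0 => /(_ a1).
  by apply: lt_le_trans; rewrite powR1 mul1r expR_gt0.
(* Here the power decays, but ln x <= x bounds it below by e^(-(1-a)x), so the integrand is at least
   e^(-(2-a)x) beyond 1. *)
have r0 : 0 < 2 - a by lra.
apply: (@lt_le_trans _ _ (expR (- (2 - a)) / (2 - a))).
  by rewrite divr_gt0// expR_gt0.
apply: (@Gamma_ge a 1 (2 - a) _ a0 ltr01 r0 (expR_ge0 _)).
move=> x x1; have x0 : 0 < x by exact: lt_le_trans x1.
rewrite /powR gt_eqF// -!expRD ler_expR.
have lnx : ln x <= x by rewrite ltW// ln_sublinear.
suff : (1 - a) * ln x <= (1 - a) * x by lra.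
by rewrite ler_wpM2l// subr_ge0 ltW.
Qed.

End PowerKernel.

(** * The beta integral and the convolution of power kernels *)

Section Convolution.
Context {R : realType}.
Local Notation mu := (@lebesgue_measure R).
Implicit Types a b x y s t : R.

Lemma trunc_powM a x y : 0 < x ->
  trunc_pow a (x * y) = x `^ (a - 1) * trunc_pow a y.
Proof.
move=> x0; rewrite /trunc_pow pmulr_rgt0//; case: ifPn => [y0|_].
  by rewrite powRM// ltW.
by rewrite mulr0.
Qed.

(** Euler's beta integral, since the truncations leave only []0, 1[]. It is extended-real because
    finiteness comes out of [Gamma_beta] only later. *)
Let beta a b : \bar R := (\int[mu]_s (trunc_pow a (1 - s) * trunc_pow b s)%:E)%E.

Lemma measurable_trunc_pow_conv a b x :
  measurable_fun setT (fun s => trunc_pow a (x - s) * trunc_pow b s).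
Proof.
apply: measurable_funM; last exact: measurable_trunc_pow.
apply: (measurableT_comp (measurable_trunc_pow _)).
exact: measurable_funB.
Qed.

(** Substituting x s for s pulls out x * x^(a-1) * x^(b-1). For [x <= 0] no [s] makes both factors
    nonzero. *)
Let trunc_pow_conv_scale a b x : 0 < a -> 0 < b ->
  (\int[mu]_s (trunc_pow a (x - s) * trunc_pow b s)%:E =
   (trunc_pow (a + b) x)%:E * beta a b)%E.
Proof.
move=> a0 b0; have [x0|x0] := leP x 0.
  rewrite trunc_pow_le0// mul0e integral0_eq// => s _.
  have [s0|s0] := leP s 0; first by rewrite (trunc_pow_le0 b s0) mulr0.
  by rewrite trunc_pow_le0 ?mul0r// subr_le0 (le_trans x0)// ltW.
have conv0 y s : (0 <= (trunc_pow a (y - s) * trunc_pow b s)%:E)%E.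
  by rewrite lee_fin mulr_ge0 ?trunc_pow_ge0.
have mconv y : measurable_fun setT
    (fun s => (trunc_pow a (y - s) * trunc_pow b s)%:E).
  by apply/measurable_EFinP; exact: measurable_trunc_pow_conv.
rewrite (ge0_integral_affine 0 x0 (mconv x) (conv0 x)).
under eq_integral => s _.
  rewrite addr0 -[X in X - _]mulr1 -mulrBr !trunc_powM// mulrACA EFinM.
  over.
rewrite ge0_integralZl//; last 2 first.
- exact: mconv.
- by rewrite lee_fin mulr_ge0 ?powR_ge0.
rewrite muleA -EFinM trunc_powE//; congr (_%:E * _)%E.
have xn : x != 0 by rewrite gt_eqF.
rewrite -{1}(powRr1 (ltW x0)) -!powRD ?xn ?implybT//.
by congr (_ `^ _); ring.
Qed.

Let measurable_shear a b : measurable_fun [set: R * R]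
  (fun z : R * R => (trunc_pow b z.1 * trunc_pow a (z.2 - z.1) * expR (- z.2))%:E).
Proof.
apply/measurable_EFinP; apply: measurable_funM; last first.
  by apply: measurableT_comp => //; apply: measurableT_comp.
apply: measurable_funM.
  by apply: (measurableT_comp (measurable_trunc_pow _)).
apply: (measurableT_comp (measurable_trunc_pow _)).
exact: measurable_funB.
Qed.

(* Tonelli for the double integral of [x^(a-1) y^(b-1) e^(-x-y)], in the
   coordinates [y] and [x + y]. *)
Let Gamma_beta a b : 0 < a -> 0 < b ->
  ((Gamma a * Gamma b)%:E = beta a b * (Gamma (a + b))%:E)%E.
Proof.
move=> a0 b0.
transitivity (\int[mu]_s \int[mu]_x
    (trunc_pow b s * trunc_pow a (x - s) * expR (- x))%:E)%E.
  rewrite mulrC EFinM -!Gamma_integral//.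
  rewrite -ge0_integralZr//; last 3 first.
  - by apply/measurable_EFinP; exact: measurable_trunc_pow_exp.
  - by move=> s _; rewrite lee_fin mulr_ge0 ?trunc_pow_ge0 ?expR_ge0.
  - by apply: integral_ge0 => s _; rewrite lee_fin mulr_ge0 ?trunc_pow_ge0 ?expR_ge0.
  apply: eq_integral => s _.
  rewrite -(@ge0_integral_shift R s) //; last 2 first.
  - by apply/measurable_EFinP; exact: measurable_trunc_pow_exp.
  - by move=> x; rewrite lee_fin mulr_ge0 ?trunc_pow_ge0 ?expR_ge0.
  rewrite -ge0_integralZl//; last 3 first.
  - apply/measurable_EFinP; apply: (measurableT_comp (measurable_trunc_pow_exp a)).
    exact: measurable_funB.
  - by move=> x _; rewrite lee_fin mulr_ge0 ?trunc_pow_ge0 ?expR_ge0.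
  - by rewrite lee_fin mulr_ge0 ?trunc_pow_ge0 ?expR_ge0.
  apply: eq_integral => x _; rewrite -EFinM mulrACA -expRD.
  by congr (_ * expR _)%:E; ring.
rewrite (@fubini_tonelli _ _ _ _ R mu mu (fun z : R * R =>
  (trunc_pow b z.1 * trunc_pow a (z.2 - z.1) * expR (- z.2))%:E))//=; last 2 first.
- exact: measurable_shear.
- by move=> z; rewrite lee_fin !mulr_ge0 ?trunc_pow_ge0 ?expR_ge0.
rewrite -Gamma_integral ?addr_gt0// -ge0_integralZl//; last 3 first.
- by apply/measurable_EFinP; exact: measurable_trunc_pow_exp.
- by move=> x _; rewrite lee_fin mulr_ge0 ?trunc_pow_ge0 ?expR_ge0.
- by apply: integral_ge0 => s _; rewrite lee_fin mulr_ge0 ?trunc_pow_ge0.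
apply: eq_integral => x _.
under eq_integral do rewrite [trunc_pow b _ * _]mulrC EFinM.
rewrite ge0_integralZr//; last 2 first.
- by apply/measurable_EFinP; exact: measurable_trunc_pow_conv.
- by move=> s _; rewrite lee_fin mulr_ge0 ?trunc_pow_ge0.
by rewrite trunc_pow_conv_scale// EFinM muleA [in RHS](muleC (beta a b)).
Qed.

Let betaE a b : 0 < a -> 0 < b ->
  beta a b = (Gamma a * Gamma b / Gamma (a + b))%:E.
Proof.
move=> a0 b0; have := Gamma_beta a0 b0; have ab0 := addr_gt0 a0 b0.
(* An infinite beta integral would make a product of two real Gamma values infinite, because
   [Gamma (a + b)] is positive. *)
case: (beta a b) => [r| |].
- by rewrite -EFinM => -[->]; rewrite mulfK// gt_eqF// Gamma_gt0.
- by rewrite gt0_mulye// lte_fin Gamma_gt0.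
- by rewrite gt0_mulNye// lte_fin Gamma_gt0.
Qed.

Definition frac_kernel a x : R := trunc_pow a x / Gamma a.

Lemma frac_kernel_ge0 a x : 0 < a -> 0 <= frac_kernel a x.
Proof. by move=> a0; rewrite divr_ge0 ?trunc_pow_ge0// ltW// Gamma_gt0. Qed.

Lemma frac_kernel_le0 a x : x <= 0 -> frac_kernel a x = 0.
Proof. by move=> x0; rewrite /frac_kernel trunc_pow_le0// mul0r. Qed.

Lemma frac_kernel1 x : 0 < x -> frac_kernel 1 x = 1.
Proof.
by move=> x0; rewrite /frac_kernel trunc_powE// subrr powRr0 Gamma1 divr1.
Qed.

Lemma measurable_frac_kernel a : measurable_fun setT (frac_kernel a).
Proof. by apply: measurable_funM => //; exact: measurable_trunc_pow. Qed.

(** From order 1 on the kernel is not singular at 0, so on [[0, t]] it is bounded by its value at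
    [t]. Integrability against L^1 functions rests on this. *)
Lemma frac_kernel_nondecreasing a x y : 1 <= a -> x <= y ->
  frac_kernel a x <= frac_kernel a y.
Proof.
move=> a1 xy; have a0 : 0 < a by exact: lt_le_trans a1.
have [x0|x0] := leP x 0; first by rewrite frac_kernel_le0// frac_kernel_ge0.
have y0 := lt_le_trans x0 xy.
have g0 : 0 <= (Gamma a)^-1 :> R by rewrite invr_ge0 ltW// Gamma_gt0.
rewrite /frac_kernel !trunc_powE// ler_wpM2r//.
by apply: ge0_ler_powR; rewrite ?nnegrE ?subr_ge0// ltW.
Qed.

Lemma frac_kernel_conv a b x : 0 < a -> 0 < b ->
  (\int[mu]_s (frac_kernel a (x - s) * frac_kernel b s)%:E =
   (frac_kernel (a + b) x)%:E)%E.
Proof.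
move=> a0 b0; have ab0 := addr_gt0 a0 b0.
under eq_integral do rewrite mulrACA EFinM.
rewrite ge0_integralZr//; last 3 first.
- by apply/measurable_EFinP; exact: measurable_trunc_pow_conv.
- by move=> s _; rewrite lee_fin mulr_ge0 ?trunc_pow_ge0.
- by rewrite lee_fin -invfM invr_ge0 mulr_ge0 ?ltW ?Gamma_gt0.
rewrite trunc_pow_conv_scale// betaE// -!EFinM /frac_kernel; congr EFin.
move: (Gamma_gt0 a0) (Gamma_gt0 b0) (Gamma_gt0 ab0).
move: (Gamma a) (Gamma b) (Gamma (a + b)) (trunc_pow _ _) => ga gb gab p.
by move=> ga0 gb0 gab0; field; rewrite !gt_eqF.
Qed.

End Convolution.

(** * Riemann-Liouville integrals and their semigroup law *)

Section FracIntegral.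
Context {R : realType}.
Local Notation mu := (@lebesgue_measure R).
Implicit Types (a b x y s t : R) (phi psi : R -> R).

(* The Riemann-Liouville integral of [phi] from [0] to [t], when [phi] vanishes
   on the negative reals. *)
Definition frac_integral a phi t : R :=
  \int[mu]_s (frac_kernel a (t - s) * phi s).

(** Stated for a single [t]: below order 1 the singular kernel is integrable against a general L^1
    function only for almost every [t]. *)
Definition frac_integrable a phi t :=
  mu.-integrable setT (EFin \o (fun s => frac_kernel a (t - s) * phi s)).

Lemma measurable_frac_kernelB a t :
  measurable_fun setT (fun s : R => frac_kernel a (t - s)).
Proof.
apply: (measurableT_comp (measurable_frac_kernel _)); exact: measurable_funB.
Qed.

Lemma measurable_frac_kernel_conv a phi : measurable_fun setT phi ->
  measurable_fun [set: R * R]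
    (fun z : R * R => (frac_kernel a (z.1 - z.2) * phi z.2)%:E).
Proof.
move=> mphi; apply/measurable_EFinP; apply: measurable_funM; last first.
  exact: measurableT_comp.
apply: (measurableT_comp (measurable_frac_kernel _)); exact: measurable_funB.
Qed.

(** Positive and negative parts are integrated separately, so Tonelli gives measurability without
    integrability. *)
Lemma measurable_frac_integral a phi : measurable_fun setT phi ->
  measurable_fun setT (frac_integral a phi).
Proof.
move=> mphi; apply: measurableT_comp => //.
have mk := measurable_frac_kernel_conv a mphi.
pose k (z : R * R) := (frac_kernel a (z.1 - z.2) * phi z.2)%:E.
rewrite [X in measurable_fun _ X](_ : _ =
    (fubini_F mu k^\+ \- fubini_F mu k^\-)%E); last first.
  apply/funext => s; rewrite [LHS]integralE.
  congr (_ - _)%E; apply: eq_integral => u _.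
    by rewrite -[LHS]/((k \o (fun v => (s, v)))^\+%E u) funepos_comp.
  by rewrite -[LHS]/((k \o (fun v => (s, v)))^\-%E u) funeneg_comp.
apply: emeasurable_funB; apply: measurable_fun_fubini_tonelli_F => //.
- exact: measurable_funepos mk.
- exact: measurable_funeneg mk.
Qed.

Lemma frac_kernel_bounded_integrable a phi t : 1 <= a ->
  mu.-integrable setT (EFin \o phi) -> (forall s, s < 0 -> phi s = 0) ->
  frac_integrable a phi t.
Proof.
move=> a1 iphi phi0; have a0 : 0 < a by exact: lt_le_trans a1.
have mphi : measurable_fun setT phi.
  by apply/measurable_EFinP; exact: measurable_int iphi.
apply: (le_integrable _ _ _ (integrableZl _ (frac_kernel a t) iphi)) => //.
  apply/measurable_EFinP; apply: measurable_funM => //.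
  exact: measurable_frac_kernelB.
move=> s _ /=; rewrite lee_fin normrM [leRHS]normrM.
have [s0|s0] := ltP s 0; first by rewrite phi0// normr0 !mulr0.
rewrite ler_wpM2r// !ger0_norm ?frac_kernel_ge0//.
by rewrite frac_kernel_nondecreasing// gerBl.
Qed.

(** On the support of [phi] the kernel is at most its value at [t]. This bound later sends the
    remainder of the telescoped series to 0. *)
Lemma frac_integral_norm_le a phi t : 1 <= a ->
  mu.-integrable setT (EFin \o phi) -> (forall s, s < 0 -> phi s = 0) ->
  `|frac_integral a phi t| <= frac_kernel a t * \int[mu]_s `|phi s|.
Proof.
move=> a1 iphi phi0; have a0 : 0 < a by exact: lt_le_trans a1.
have ik := frac_kernel_bounded_integrable t a1 iphi phi0.
apply: (le_trans (le_normr_Rintegral _ ik)) => //.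
rewrite -RintegralZl//; last exact: integrable_norm.
apply: le_Rintegral => //.
- exact: integrable_norm ik.
- by apply: (integrableZl _ (frac_kernel a t) (integrable_norm iphi)).
move=> s _; rewrite normrM.
have [s0|s0] := ltP s 0; first by rewrite phi0// normr0 !mulr0.
rewrite ler_wpM2r// ger0_norm ?frac_kernel_ge0//.
by rewrite frac_kernel_nondecreasing// gerBl.
Qed.

Lemma frac_kernel_convB a b t u : 0 < a -> 0 < b ->
  (\int[mu]_s (frac_kernel a (t - s) * frac_kernel b (s - u))%:E =
   (frac_kernel (a + b) (t - u))%:E)%E.
Proof.
move=> a0 b0; rewrite -(frac_kernel_conv (t - u) a0 b0).
rewrite -(@ge0_integral_shift R u
  (fun s => (frac_kernel a (t - u - s) * frac_kernel b s)%:E)).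
- by apply: eq_integral => s _; congr (frac_kernel a _ * _)%:E; ring.
- apply/measurable_EFinP; apply: measurable_funM.
    exact: measurable_frac_kernelB.
  exact: measurable_frac_kernel.
- by move=> s; rewrite lee_fin mulr_ge0 ?frac_kernel_ge0.
Qed.

Lemma frac_integrable_kernel a b t : 0 < a -> 0 < b ->
  frac_integrable a (frac_kernel b) t.
Proof.
move=> a0 b0; apply/integrableP; split.
  apply/measurable_EFinP; apply: measurable_funM.
    exact: measurable_frac_kernelB.
  exact: measurable_frac_kernel.
under eq_integral => s _.
  rewrite gee0_abs; last by rewrite lee_fin mulr_ge0 ?frac_kernel_ge0.
  over.
by rewrite frac_kernel_conv// ltry.
Qed.

Lemma frac_integral_kernel a b t : 0 < a -> 0 < b ->
  frac_integral a (frac_kernel b) t = frac_kernel (a + b) t.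
Proof. by move=> a0 b0; rewrite /frac_integral /Rintegral frac_kernel_conv. Qed.

(** [z.1] is the intermediate time, [z.2] the argument of [phi]. Integrating [z.2] first gives the
    iterated integral; integrating [z.1] first merges the kernels. *)
Let semigroup_integrand a b phi t (z : R * R) : \bar R :=
  (frac_kernel a (t - z.1) * (frac_kernel b (z.1 - z.2) * phi z.2))%:E.

Let measurable_semigroup_integrand a b phi t : measurable_fun setT phi ->
  measurable_fun setT (semigroup_integrand a b phi t).
Proof.
move=> mphi; apply/measurable_EFinP; apply: measurable_funM.
  by apply: (measurableT_comp (measurable_frac_kernelB a t)).
by have /measurable_EFinP := measurable_frac_kernel_conv b mphi.
Qed.

Let semigroup_integrandE a b phi t u (s : R) :
  semigroup_integrand a b phi t (s, u) =
  ((frac_kernel a (t - s) * frac_kernel b (s - u))%:E * (phi u)%:E)%E.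
Proof. by rewrite /semigroup_integrand/= mulrA EFinM. Qed.

Let measurable_kernels a b t u :
  measurable_fun setT (fun s : R => frac_kernel a (t - s) * frac_kernel b (s - u)).
Proof.
apply: measurable_funM; first exact: measurable_frac_kernelB.
apply: (measurableT_comp (measurable_frac_kernel _)); exact: measurable_funB.
Qed.

Let integrable_kernels a b t u : 0 < a -> 0 < b ->
  mu.-integrable setT
    (fun s => (frac_kernel a (t - s) * frac_kernel b (s - u))%:E).
Proof.
move=> a0 b0; apply/integrableP; split.
  by apply/measurable_EFinP; exact: measurable_kernels.
under eq_integral => s _.
  rewrite gee0_abs; last by rewrite lee_fin mulr_ge0 ?frac_kernel_ge0.
  over.
by rewrite frac_kernel_convB// ltry.
Qed.

(** Integrating the absolute value over [z.1] first leaves the kernel of order [a + b] against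
    [|phi|], integrable by assumption. *)
Let integrable_semigroup_integrand a b phi t : 0 < a -> 0 < b ->
  mu.-integrable setT (EFin \o phi) -> frac_integrable (a + b) phi t ->
  (mu \x mu)%E.-integrable setT (semigroup_integrand a b phi t).
Proof.
move=> a0 b0 iphi ik; have ab0 := addr_gt0 a0 b0.
have mphi : measurable_fun setT phi.
  by apply/measurable_EFinP; exact: measurable_int iphi.
apply/integrable21ltyP; first exact: measurable_semigroup_integrand.
move/integrableP : ik => [_]; apply: le_lt_trans.
apply: ge0_le_integral => //.
- by move=> u _; exact: integral_ge0.
- apply: (@measurable_fun_fubini_tonelli_G _ _ _ _ R mu
    (abse \o semigroup_integrand a b phi t)) => //.
    by apply: measurableT_comp => //; exact: measurable_semigroup_integrand.
  by move=> z; exact: abse_ge0.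
- apply: measurableT_comp => //; apply/measurable_EFinP.
  by apply: measurable_funM => //; exact: measurable_frac_kernelB.
move=> u _.
under eq_integral => s _.
  rewrite semigroup_integrandE abseM gee0_abs; last first.
    by rewrite lee_fin mulr_ge0 ?frac_kernel_ge0.
  over.
rewrite ge0_integralZr//.
- rewrite frac_kernel_convB//= normrM.
  by rewrite [X in (_ <= (X * _)%:E)%E]ger0_norm ?frac_kernel_ge0.
- by apply/measurable_EFinP; exact: measurable_kernels.
- by move=> s _; rewrite lee_fin mulr_ge0 ?frac_kernel_ge0.
Qed.

(** Only almost every section is integrable. There, a nonzero outer kernel can be divided out to
    make the inner integrand integrable; where it is zero, both sides vanish. *)
Let ae_semigroup a b phi t : 0 < a -> 0 < b ->
  mu.-integrable setT (EFin \o phi) -> frac_integrable (a + b) phi t ->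
  ae_eq mu setT (fubini_F mu (semigroup_integrand a b phi t))
    (fun s => (frac_kernel a (t - s) * frac_integral b phi s)%:E).
Proof.
move=> a0 b0 iphi ik.
have := ae_integrable1 (integrable_semigroup_integrand a0 b0 iphi ik).
apply: filterS => s ints _; rewrite /fubini_F.
have [k0|k0] := eqVneq (frac_kernel a (t - s)) 0.
  rewrite k0 mul0r integral0_eq// => u _.
  by rewrite /semigroup_integrand/= k0 mul0r.
have ib : mu.-integrable setT (fun u => (frac_kernel b (s - u) * phi u)%:E).
  have := @integrableZl _ _ _ mu setT measurableT (frac_kernel a (t - s))^-1 _ ints.
  by apply: eq_integrable => // u _; rewrite /= -EFinM mulKf.
under eq_integral do rewrite /semigroup_integrand/= EFinM.
rewrite integralZl// [RHS]EFinM /frac_integral /Rintegral fineK//.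
exact: integrable_fin_num ib.
Qed.

(** Fubini. With [1 <= a + b] the merged kernel is bounded on the relevant range, so the law holds
    at every [t], although the inner integral may converge only almost everywhere. *)
Theorem frac_integral_semigroup a b phi t : 0 < a -> 0 < b -> 1 <= a + b ->
  mu.-integrable setT (EFin \o phi) -> (forall s, s < 0 -> phi s = 0) ->
  frac_integrable a (frac_integral b phi) t /\
  frac_integral a (frac_integral b phi) t = frac_integral (a + b) phi t.
Proof.
move=> a0 b0 ab1 iphi phi0.
have ik := frac_kernel_bounded_integrable t ab1 iphi phi0.
have ae := ae_semigroup a0 b0 iphi ik.
have iF := integrable_semigroup_integrand a0 b0 iphi ik.
have mphi : measurable_fun setT phi.
  by apply/measurable_EFinP; exact: measurable_int iphi.
have mR : measurable_fun setT
    (fun s => (frac_kernel a (t - s) * frac_integral b phi s)%:E).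
  apply/measurable_EFinP; apply: measurable_funM.
    exact: measurable_frac_kernelB.
  exact: measurable_frac_integral.
have mF := measurable_fubini_F iF.
split.
  apply/integrableP; split=> //.
  have /integrableP[_] := integrable_fubini_F iF.
  rewrite (ge0_ae_eq_integral _ _ _ _ _ (ae_eq_abse ae))//.
  - exact: measurableT_comp.
  - exact: measurableT_comp.
  - by move=> s _; exact: abse_ge0.
  - by move=> s _; exact: abse_ge0.
rewrite /frac_integral /Rintegral; congr fine.
transitivity (\int[mu]_s fubini_F mu (semigroup_integrand a b phi t) s)%E.
  exact/esym/ae_eq_integral.
rewrite (Fubini iF); apply: eq_integral => u _.
under eq_integral do rewrite semigroup_integrandE.
rewrite integralZr//; last exact: integrable_kernels.
by rewrite frac_kernel_convB// -EFinM.
Qed.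

End FracIntegral.

(** * The Mittag-Leffler series and its termwise integration *)

Section MittagLeffler.
Context {R : realType}.
Local Notation mu := (@lebesgue_measure R).
Implicit Types (a l r s t u x : R) (phi F G : R -> R).

(** Passes from integrals over [[0, t]] to the whole line. Agreement is asked only on the open
    interval, because truncated kernels may differ from the original functions at the endpoints. *)
Lemma Rintegral_itv_eq t F G : measurable_fun setT F ->
  (forall s, s < 0 -> F s = 0) -> (forall s, t <= s -> F s = 0) ->
  (forall s, 0 < s < t -> F s = G s) ->
  \int[mu]_(s in `[0, t]) G s = \int[mu]_s F s.
Proof.
move=> mF F0 Ft FG; congr fine.
have FGoo : {in `]0, t[%classic, F =1 G}.
  by move=> s; rewrite inE/= in_itv/= => /FG.
have mG : measurable_fun `]0, t[ G.
  by apply: eq_measurable_fun FGoo _; exact: measurable_funTS.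
have mGoc : measurable_fun `]0, t] G by exact/measurable_fun_itv_bndo_bndcP.
rewrite -integral_itv_obnd_cbnd; last exact/measurable_EFinP.
rewrite -integral_itv_bndo_bndc; last exact/measurable_EFinP.
transitivity (\int[mu]_(s in `]0%R, t[) (F s)%:E)%E.
  by apply: eq_integral => s /FGoo ->.
rewrite integral_itv_obnd_cbnd; last exact/measurable_EFinP/measurable_funTS.
rewrite [LHS]integral_mkcond; apply: eq_integral => s _; rewrite patchE.
case: ifPn => //; rewrite notin_setE/= in_itv/= => /negP.
rewrite negb_and -ltNge -leNgt.
by move=> /orP[/F0|/Ft] ->.
Qed.

Definition mittag_leffler_term a x (k : nat) : R := x ^+ k / Gamma (a * k%:R + 1).

Lemma mittag_leffler_arg_gt0 a k : 0 < a -> 0 < a * k%:R + 1.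
Proof. by move=> a0; rewrite ltr_wpDl// mulr_ge0// ltW. Qed.

Lemma mittag_leffler_term_ge0 a r k : 0 < a -> 0 <= r ->
  0 <= mittag_leffler_term a r k.
Proof.
move=> a0 r0; rewrite divr_ge0 ?exprn_ge0// ltW// Gamma_gt0//.
exact: mittag_leffler_arg_gt0.
Qed.

(* [Gamma_ge_powR] at the point [M] with [M `^ a = 2 * r + 1] gives a geometric
   majorant of ratio less than [1 / 2]. *)
Lemma mittag_leffler_cvg_ge0 a r : 0 < a -> 0 <= r ->
  cvgn (series (mittag_leffler_term a r)).
Proof.
move=> a0 r0; pose q := 2 * r + 1; have q0 : 0 < q by rewrite /q; lra.
pose M := q `^ a^-1; have M0 : 0 < M by exact: powR_gt0.
have Ma : M `^ a = q by rewrite -powRrM mulVf ?gt_eqF// powRr1// ltW.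
have rq : `|r / q| < 1.
  have rq0 : 0 <= r / q by rewrite divr_ge0// ltW.
  by rewrite ger0_norm// ltr_pdivrMr// mul1r /q; lra.
apply: (@series_le_cvg _ _ (geometric (expR M) (r / q)));
  last exact: is_cvg_geometric_series.
- by move=> k; exact: mittag_leffler_term_ge0.
- by move=> k; rewrite /geometric/= mulr_ge0 ?expR_ge0// exprn_ge0// divr_ge0// ltW.
move=> k; rewrite /geometric/= /mittag_leffler_term.
rewrite ler_pdivrMr ?Gamma_gt0 ?mittag_leffler_arg_gt0//.
have /(_ (a * k%:R)) := Gamma_ge_powR M0.
have ak0 : 0 <= a * k%:R by rewrite mulr_ge0// ltW.
rewrite powRrM Ma powR_mulrn ?(ltW q0)// expRN => /(_ ak0) Gle.
apply: le_trans (ler_wpM2l _ Gle); last first.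
  by rewrite mulr_ge0 ?expR_ge0// exprn_ge0// divr_ge0// ltW.
rewrite expr_div_n.
have e0 : expR M != 0 by rewrite expR_eq0.
have qk : q ^+ k != 0 by rewrite expf_neq0// gt_eqF.
rewrite le_eqVlt; apply/orP; left; apply/eqP.
by move: (expR M) (q ^+ k) (r ^+ k) e0 qk => e p w e0 p0; field; rewrite e0 p0.
Qed.

Lemma mittag_leffler_cvg a x : 0 < a ->
  series (mittag_leffler_term a x) @ \oo --> mittag_leffler a x.
Proof.
move=> a0.
have normE : (fun k => `|mittag_leffler_term a x k|) = mittag_leffler_term a `|x|.
  apply/funext => k; rewrite /mittag_leffler_term normrM normrX normfV.
  by rewrite [X in _ / X]ger0_norm// ltW// Gamma_gt0// mittag_leffler_arg_gt0.
(* The claimed limit is by definition the [limn] of this series. *)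
suff : cvgn (series (mittag_leffler_term a x)) by [].
apply: normed_cvg.
rewrite [X in cvgn (series X)](_ : _ = mittag_leffler_term a `|x|) //.
exact: mittag_leffler_cvg_ge0.
Qed.

Lemma mittag_leffler_termE a l u k : 0 < a -> 0 < u ->
  mittag_leffler_term a (l * u `^ a) k = l ^+ k * frac_kernel (a * k%:R + 1) u.
Proof.
move=> a0 u0; rewrite /mittag_leffler_term exprMn /frac_kernel trunc_powE//.
by rewrite addrK powRrM powR_mulrn ?powR_ge0// mulrA.
Qed.

(** The cut at [u <= 0], including 0 where the series equals 1, matches [frac_kernel], so the
    expansion below holds for every [u]. *)
Definition mittag_leffler_kernel a l u : R :=
  if 0 < u then mittag_leffler a (l * u `^ a) else 0.

Lemma mittag_leffler_kernel_cvg a l u : 0 < a ->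
  series (fun k => l ^+ k * frac_kernel (a * k%:R + 1) u) @ \oo -->
  mittag_leffler_kernel a l u.
Proof.
move=> a0; rewrite /mittag_leffler_kernel; case: ltP => u0.
  rewrite (_ : (fun k => _) = mittag_leffler_term a (l * u `^ a)).
    exact: mittag_leffler_cvg.
  by apply/funext => k; rewrite mittag_leffler_termE.
rewrite (_ : series _ = fun=> 0); first exact: cvg_cst.
apply/funext => n; rewrite /series/= big1// => k _.
by rewrite frac_kernel_le0// mulr0.
Qed.

Let integrand a l phi t n s : R :=
  series (fun k => l ^+ k * frac_kernel (a * k%:R + 1) (t - s)) n * phi s.

Let integrand_cvg a l phi t s : 0 < a ->
  (integrand a l phi t n s)%:E @[n --> \oo] -->
  (mittag_leffler_kernel a l (t - s) * phi s)%:E.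
Proof.
move=> a0; apply: cvg_EFin; first exact: nearW.
by apply: cvgMl; exact: mittag_leffler_kernel_cvg.
Qed.

Let integrandE a l phi t n s : integrand a l phi t n s =
  \sum_(0 <= k < n) l ^+ k * (frac_kernel (a * k%:R + 1) (t - s) * phi s).
Proof.
by rewrite /integrand /series/= big_distrl/=; apply: eq_bigr => k _; rewrite mulrA.
Qed.

(** Dominated convergence for the partial sums of the kernel expansion; their pointwise limit also
    inherits measurability. *)
Lemma frac_integral_series_cvg a l phi t : 0 < a -> 0 < t ->
  mu.-integrable setT (EFin \o phi) -> (forall s, s < 0 -> phi s = 0) ->
  measurable_fun setT (fun s => mittag_leffler_kernel a l (t - s) * phi s) /\
  series (fun k => l ^+ k * frac_integral (a * k%:R + 1) phi t) @ \oo -->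
  \int[mu]_s (mittag_leffler_kernel a l (t - s) * phi s).
Proof.
move=> a0 t0 iphi phi0.
have a1 k : 1 <= a * k%:R + 1 by rewrite lerDr mulr_ge0// ltW.
have ik k := frac_kernel_bounded_integrable t (a1 k) iphi phi0.
have intE n : EFin \o integrand a l phi t n = (fun s =>
    \sum_(0 <= k < n) (l ^+ k)%:E *
      (frac_kernel (a * k%:R + 1) (t - s) * phi s)%:E)%E.
  by apply/funext => s; rewrite /= integrandE -sumEFin.
have iZ k : mu.-integrable setT (fun s => (l ^+ k)%:E *
    (frac_kernel (a * k%:R + 1) (t - s) * phi s)%:E)%E.
  exact: (integrableZl measurableT _ (ik k)).
have iint n : mu.-integrable setT (EFin \o integrand a l phi t n).
  by rewrite intE; apply: integrable_sum => // k _.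
have mint n : measurable_fun setT (EFin \o integrand a l phi t n).
  exact: measurable_int (iint n).
have mker : measurable_fun setT
    (fun s => (mittag_leffler_kernel a l (t - s) * phi s)%:E).
  by apply: emeasurable_fun_cvg mint _ => s _; exact: integrand_cvg.
split; first exact/measurable_EFinP.
(* The sum of the absolute values at [s = 0], where each kernel is largest on the support of [phi];
   it bounds all partial sums. *)
pose C := limn (series (mittag_leffler_term a (`|l| * t `^ a))).
have Ccvg : cvgn (series (mittag_leffler_term a (`|l| * t `^ a))).
  by apply: mittag_leffler_cvg_ge0 => //; rewrite mulr_ge0 ?powR_ge0.
have dom n s : `|integrand a l phi t n s| <= C * `|phi s|.
  rewrite normrM; have [s0|s0] := ltP s 0; first by rewrite phi0// normr0 !mulr0.
  rewrite ler_wpM2r//; apply: (le_trans (ler_norm_sum _ _ _)).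
  apply: le_trans (nondecreasing_cvgn_le _ Ccvg n); last first.
    apply: nondecreasing_series => k _ _.
    by apply: mittag_leffler_term_ge0 => //; rewrite mulr_ge0 ?powR_ge0.
  apply: ler_sum => k _; rewrite mittag_leffler_termE// normrM normrX.
  rewrite ler_wpM2l ?exprn_ge0// ger0_norm ?frac_kernel_ge0 ?mittag_leffler_arg_gt0//.
  by rewrite frac_kernel_nondecreasing// gerBl.
have f_f : {ae mu, forall s, setT s ->
    (EFin \o integrand a l phi t n) s @[n --> \oo] -->
    (mittag_leffler_kernel a l (t - s) * phi s)%:E}.
  by apply: aeW => s _; exact: integrand_cvg.
have ig : mu.-integrable setT (fun s => (C * `|phi s|)%:E).
  exact: (integrableZl measurableT C (integrable_norm iphi)).
have f_g : {ae mu, forall s n, setT s ->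
    (`|(EFin \o integrand a l phi t n) s| <= (C * `|phi s|)%:E)%E}.
  by apply: aeW => s n _; exact: dom.
have [ilim _ lim] := @dominated_convergence _ _ R mu setT measurableT
  (fun n => EFin \o integrand a l phi t n) _ _ mint mker f_f ig f_g.
rewrite -[X in _ --> X]fineK in lim; last exact: integrable_fin_num ilim.
move/fine_cvgP : lim => [_].
rewrite [X in X @ _ --> _](_ : _ =
  series (fun k => l ^+ k * frac_integral (a * k%:R + 1) phi t))//.
apply/funext => n.
rewrite -[LHS]/(fine (\int[mu]_s (EFin \o integrand a l phi t n) s)%E).
rewrite intE integral_sum// -[RHS]/(fine (_%:E)); congr fine.
rewrite /series/= -sumEFin; apply: eq_bigr => k _.
rewrite integralZl//; last exact: ik.
rewrite EFinM /frac_integral /Rintegral fineK//.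
exact: integrable_fin_num (ik k).
Qed.

End MittagLeffler.

(** * Linearity, causality and restriction to intervals *)

Section FracIntegralLinear.
Context {R : realType}.
Local Notation mu := (@lebesgue_measure R).
Implicit Types (a c s t : R) (phi psi F : R -> R).

(** The kernel vanishes from [s = t] on, so only the past counts. Identities known only up to [T]
    can thus be used under the integral. *)
Lemma eq_frac_integral a phi psi t : (forall s, s < t -> phi s = psi s) ->
  frac_integral a phi t = frac_integral a psi t.
Proof.
move=> pp; apply: eq_Rintegral => s _; have [st|ts] := ltP s t; first by rewrite pp.
by rewrite frac_kernel_le0 ?mul0r// subr_le0.
Qed.

Lemma frac_integral_le0 a phi t : (forall s, s < 0 -> phi s = 0) -> t <= 0 ->
  frac_integral a phi t = 0.
Proof.
move=> phi0 t0; rewrite (@eq_frac_integral _ _ (fun=> 0)).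
  rewrite /frac_integral /Rintegral integral0_eq// => s _; by rewrite mulr0.
by move=> s st; rewrite phi0// (lt_le_trans st).
Qed.

Lemma frac_integrableZ a c phi t : frac_integrable a phi t ->
  frac_integrable a (fun s => c * phi s) t.
Proof.
move=> /(integrableZl measurableT c); apply: eq_integrable => // s _ /=.
by rewrite -EFinM mulrCA.
Qed.

Lemma frac_integralZ a c phi t : frac_integrable a phi t ->
  frac_integral a (fun s => c * phi s) t = c * frac_integral a phi t.
Proof.
move=> iphi; rewrite /frac_integral -RintegralZl//.
by apply: eq_Rintegral => s _; rewrite mulrCA.
Qed.

Lemma frac_integrableD a phi psi t : frac_integrable a phi t ->
  frac_integrable a psi t -> frac_integrable a (fun s => phi s + psi s) t.
Proof.
move=> iphi /(integrableD measurableT iphi); apply: eq_integrable => // s _ /=.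
by rewrite -EFinD mulrDr.
Qed.

Lemma frac_integralD a phi psi t : frac_integrable a phi t ->
  frac_integrable a psi t ->
  frac_integral a (fun s => phi s + psi s) t =
  frac_integral a phi t + frac_integral a psi t.
Proof.
move=> iphi ipsi; rewrite /frac_integral -RintegralD//.
by apply: eq_Rintegral => s _; rewrite mulrDr.
Qed.

Lemma Rintegral_itv_frac a c phi F t : frac_integrable a phi t ->
  (forall s, s < 0 -> phi s = 0) ->
  (forall s, 0 < s < t -> c * (frac_kernel a (t - s) * phi s) = F s) ->
  \int[mu]_(s in `[0, t]) F s = c * frac_integral a phi t.
Proof.
move=> iphi phi0 phiF; rewrite /frac_integral -RintegralZl//.
apply: Rintegral_itv_eq phiF.
- by apply/measurable_EFinP;
    exact: measurable_int (integrableZl measurableT c iphi).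
- by move=> s s0; rewrite phi0// !mulr0.
- by move=> s ts; rewrite frac_kernel_le0 ?mul0r ?mulr0// subr_le0.
Qed.

(** Extension by zero turns a derivative on [[0, T]] into an integrable function on the line to
    which the semigroup law applies. *)
Lemma L1_derivative_extension (T : R) (h g : R -> R) : is_L1_derivative T h g ->
  [/\ mu.-integrable setT (EFin \o (g \_ `[0, T])),
      forall s, s < 0 -> (g \_ `[0, T]) s = 0 &
      forall t, 0 <= t <= T -> h t = h 0 + frac_integral 1 (g \_ `[0, T]) t].
Proof.
move=> [ig gE].
have ig' : mu.-integrable setT (EFin \o (g \_ `[0, T])).
  rewrite -restrict_EFin; apply: (iffLR (integrable_mkcond _ _)) ig.
  exact: measurable_itv.
have g0 s : s < 0 -> (g \_ `[0, T]) s = 0.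
  by move=> s0; rewrite patchE memNset//= in_itv/= leNgt s0.
split=> // t /andP[t0 tT]; rewrite gE ?t0//; congr (_ + _).
rewrite -[RHS]mul1r; apply: (Rintegral_itv_frac _ g0) => [|s /andP[s0 st]].
  exact: frac_kernel_bounded_integrable.
rewrite mul1r frac_kernel1 ?subr_gt0// mul1r patchE mem_set//=.
by rewrite in_itv/= ltW//= (le_trans (ltW st)).
Qed.

End FracIntegralLinear.

(** * The AB integral and its ABC derivative *)

Section AtanganaBaleanu.
Context {R : realType}.
Local Notation mu := (@lebesgue_measure R).
Variables (T alpha : R) (B f g : R -> R).
Implicit Types (b s t : R) (G : R -> R).
Hypotheses (alpha_gt0 : 0 < alpha) (alpha_lt1 : alpha < 1).
Hypothesis (B_neq0 : B alpha != 0).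
Hypothesis ig : mu.-integrable setT (EFin \o g).
Hypothesis g_lt0 : forall s, s < 0 -> g s = 0.
Hypothesis fE : forall t, 0 <= t <= T -> f t = f 0 + frac_integral 1 g t.
Local Notation lambda := (alpha / (1 - alpha)).
Local Notation AB_f := (AB_integral B alpha f).

(** This is [(h - h 0) / c] on [[0, T]], written through [g] because [f] is controlled only
    there. *)
Let AB_primitive s : R := frac_integral 1 g s +
  lambda * (f 0 * frac_kernel (alpha + 1) s + frac_integral (alpha + 1) g s).

Let AB_primitive_frac b t : 0 < b ->
  frac_integrable b AB_primitive t /\
  frac_integral b AB_primitive t = frac_integral (b + 1) g t +
    lambda * (f 0 * frac_kernel (b + (alpha + 1)) t +
              frac_integral (b + (alpha + 1)) g t).
Proof.
move=> b0.
have a1 : 0 < alpha + 1 by exact: addr_gt0.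
have [i1 e1] := @frac_integral_semigroup R b 1 g t b0 ltr01
  (ler_wpDl (ltW b0) (lexx _)) ig g_lt0.
have [i2 e2] := @frac_integral_semigroup R b (alpha + 1) g t b0 a1
  (ler_wpDl (ltW b0) (ler_wpDl (ltW alpha_gt0) (lexx _))) ig g_lt0.
have i3 := frac_integrable_kernel t b0 a1.
have i4 := frac_integrableZ (f 0) i3.
have i5 := frac_integrableD i4 i2.
have i6 := frac_integrableZ lambda i5.
split; first exact: frac_integrableD.
have e4 := frac_integralZ (f 0) i3; rewrite (frac_integral_kernel _ b0 a1) in e4.
rewrite (frac_integralD i1 i6) (frac_integralZ _ i5) (frac_integralD i4 i2).
exact: (congr2 +%R e1 (congr1 ( *%R lambda) (congr2 +%R e4 e2))).
Qed.

Let AB_primitive_le0 s : s <= 0 -> AB_primitive s = 0.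
Proof.
move=> s0; rewrite /AB_primitive !frac_integral_le0// frac_kernel_le0//.
by rewrite mulr0 !add0r mulr0.
Qed.

Let AB_integralE t : 0 <= t <= T ->
  AB_f t = (1 - alpha) / B alpha * (f 0 + AB_primitive t).
Proof.
move=> tT; rewrite /AB_integral /AB_primitive.
have a1 : 1 <= alpha + 1 by rewrite lerDr ltW.
have [i1 e1] := @frac_integral_semigroup R alpha 1 g t alpha_gt0 ltr01 a1 ig g_lt0.
have i2 := frac_integrable_kernel t alpha_gt0 ltr01.
have i3 := frac_integrableZ (f 0) i2.
have i4 := frac_integrableD i3 i1.
have G0 : Gamma alpha != 0 by rewrite gt_eqF// Gamma_gt0.
(* Inside the interval [f] is [f 0] times the kernel of order 1 plus the primitive of [g]; the
   convolution and semigroup laws raise both orders by [alpha]. *)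
have -> : \int[mu]_(s in `[0, t]) ((t - s) `^ (alpha - 1) * f s) =
    Gamma alpha * (f 0 * frac_kernel (alpha + 1) t + frac_integral (alpha + 1) g t).
  rewrite -e1 -(frac_integral_kernel t alpha_gt0 ltr01) -(frac_integralZ _ i2).
  rewrite -(frac_integralD i3 i1); apply: (Rintegral_itv_frac i4) => s.
    move=> s0; rewrite (frac_integral_le0 _ g_lt0 (ltW s0)).
    by rewrite frac_kernel_le0 ?(ltW s0)// mulr0 addr0.
  move=> /andP[s0 st]; rewrite (frac_kernel1 s0) mulr1 -fE; last first.
    by case/andP: tT => _; rewrite (ltW s0); apply: le_trans; exact: ltW.
  by rewrite /frac_kernel trunc_powE ?subr_gt0// mulrA mulrCA mulfV// mulr1.
rewrite fE//.
have d0 : 1 - alpha != 0 by rewrite subr_eq0 gt_eqF.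
move: (frac_integral 1 g t) (frac_kernel _ _) (frac_integral _ g t) => x y z.
by field; rewrite G0 d0 B_neq0.
Qed.

(** The derivative of [c] times [AB_primitive], each order lowered by one. The kernel of order
    [alpha] is singular at 0 but integrable near it. *)
Let AB_density s : R := (1 - alpha) / B alpha *
  (g s + lambda * (f 0 * frac_kernel alpha s + frac_integral alpha g s)).

Let AB_density_frac t : frac_integrable 1 AB_density t /\
  frac_integral 1 AB_density t = (1 - alpha) / B alpha * AB_primitive t.
Proof.
have i1 := frac_kernel_bounded_integrable t (lexx 1) ig g_lt0.
have a1 : 1 <= 1 + alpha by rewrite lerDl ltW.
have [i2 e2] := @frac_integral_semigroup R 1 alpha g t ltr01 alpha_gt0 a1 ig g_lt0.
have i3 := frac_integrable_kernel t ltr01 alpha_gt0.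
have i4 := frac_integrableZ (f 0) i3.
have i5 := frac_integrableD i4 i2.
have i6 := frac_integrableZ lambda i5.
have i7 := frac_integrableD i1 i6.
split; first exact: frac_integrableZ.
rewrite (frac_integralZ _ i7) (frac_integralD i1 i6) (frac_integralZ _ i5).
rewrite (frac_integralD i4 i2) (frac_integralZ _ i3) e2.
rewrite (frac_integral_kernel _ ltr01 alpha_gt0).
by rewrite [1 + alpha]addrC.
Qed.

Lemma AB_integral_abs_continuous : 0 <= T -> abs_continuous T AB_f.
Proof.
move=> T0; exists AB_density.
have D0 s : s < 0 -> AB_density s = 0.
  move=> s0; rewrite /AB_density g_lt0// frac_kernel_le0 ?(ltW s0)//.
  by rewrite (frac_integral_le0 _ g_lt0 (ltW s0)) !(mulr0, addr0).
split.
  (* With endpoint [T + 1] the kernel of order 1 equals 1 on all of [[0, T]]; with endpoint [T] it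
     would vanish at [s = T]. *)
  have [iD _] := AB_density_frac (T + 1).
  have : mu.-integrable `[0, T]
      (EFin \o (fun s => frac_kernel 1 (T + 1 - s) * AB_density s)).
    by apply: integrableS iD => //; exact: measurable_itv.
  apply: eq_integrable => // s; rewrite inE/= in_itv/= => /andP[_ sT].
  by rewrite frac_kernel1 ?mul1r// subr_gt0 ltr_pwDr.
move=> t tT; rewrite !AB_integralE ?lexx//.
rewrite (AB_primitive_le0 (lexx 0)) addr0 mulrDr; congr (_ + _).
have [iD <-] := AB_density_frac t.
apply/esym; rewrite -[RHS]mul1r; apply: Rintegral_itv_frac => // s /andP[s0 st].
by rewrite mul1r frac_kernel1 ?subr_gt0// mul1r.
Qed.

(* Integrating [h] once before applying the kernel of order [alpha * k] makes
   the choice of the representative [G] of its derivative irrelevant. *)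
Let frac_integral_derivative G k t : is_L1_derivative T AB_f G -> 0 < t <= T ->
  frac_integral (alpha * k%:R + 1) (G \_ `[0, T]) t =
  (1 - alpha) / B alpha * (frac_integral (alpha * k%:R + 1) g t +
    lambda * (f 0 * frac_kernel (alpha * k.+1%:R + 1) t +
              frac_integral (alpha * k.+1%:R + 1) g t)).
Proof.
move=> GE /andP[t0 tT]; have T0 : 0 <= T by exact: le_trans (ltW t0) tT.
have [iG G0 hE] := L1_derivative_extension GE.
have J1 s : s <= T ->
    frac_integral 1 (G \_ `[0, T]) s = (1 - alpha) / B alpha * AB_primitive s.
  move=> sT; have [s0|s0] := leP s 0.
    by rewrite frac_integral_le0// AB_primitive_le0// mulr0.
  have := hE s; rewrite (ltW s0) sT => /(_ isT).
  rewrite !AB_integralE ?(ltW s0) ?lexx//.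
  by rewrite (AB_primitive_le0 (lexx 0)) addr0 mulrDr => /addrI.
have kS : alpha * k.+1%:R + 1 = alpha * k%:R + (alpha + 1) by rewrite -natr1; ring.
(* For [k = 0] the order [alpha * k] is 0, outside the semigroup law, and [J1] answers directly. *)
rewrite kS; case: k {kS} => [|k]; first by rewrite mulr0 !add0r J1.
set b := alpha * k.+1%:R; have b0 : 0 < b by rewrite mulr_gt0.
have [_ <-] := @frac_integral_semigroup R b 1 _ t b0 ltr01
  (ler_wpDl (ltW b0) (lexx _)) iG G0.
have [i <-] := AB_primitive_frac t b0.
rewrite -(frac_integralZ _ i); apply: eq_frac_integral => s st.
by rewrite J1// (le_trans (ltW st)).
Qed.

(** Each summand contains a difference of consecutive terms in [g] and one kernel term of the next
    index. Hence the last series runs to [n.+1]: its term of index 0 is 1 and cancels the [f 0]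
    inside [f t]. *)
Let series_telescope G t n : is_L1_derivative T AB_f G -> 0 < t <= T ->
  series (fun k => (- lambda) ^+ k *
    frac_integral (alpha * k%:R + 1) (G \_ `[0, T]) t) n =
  (1 - alpha) / B alpha * (f t
    - (- lambda) ^+ n * frac_integral (alpha * n%:R + 1) g t
    - f 0 * series
      (fun k => (- lambda) ^+ k * frac_kernel (alpha * k%:R + 1) t) n.+1).
Proof.
move=> GE tT; rewrite /series/=; elim: n => [|n IH].
  rewrite big_geq// big_nat1 expr0 !mul1r mulr0 add0r fE; last first.
    by case/andP: tT => /ltW -> ->.
  by rewrite frac_kernel1; [ring | case/andP: tT].
rewrite big_nat_recr//= IH [in RHS]big_nat_recr//= frac_integral_derivative//.
rewrite exprSr.
move: (\sum_(_ <= _ < _) _) ((- _) ^+ n) => S p.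
move: (frac_integral (alpha * n%:R + 1) g t).
move: (frac_integral (alpha * n.+1%:R + 1) g t).
move: (frac_kernel (alpha * n.+1%:R + 1) t) => x y z.
by ring.
Qed.

Lemma ABC_derivative_AB_integral t : 0 < t <= T ->
  ABC_derivative T B alpha AB_f t =
  f t - mittag_leffler alpha (- lambda * t `^ alpha) * f 0.
Proof.
move=> tT; have [t0 tT'] := andP tT.
have T0 : 0 <= T by exact: le_trans (ltW t0) tT'.
(* Absolute continuity of the AB integral ensures that the chosen representative is not the default
   value. *)
have GE : is_L1_derivative T AB_f (L1_derivative T AB_f).
  exact: (xgetPex (fun=> 0) (AB_integral_abs_continuous T0)).
have [iG G0 _] := L1_derivative_extension GE.
rewrite /ABC_derivative; set G := L1_derivative T AB_f in GE iG G0 *.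
have [mF Fcvg] := frac_integral_series_cvg (- lambda) alpha_gt0 t0 iG G0.
have -> : \int[mu]_(s in `[0, t])
    (mittag_leffler alpha (- lambda * (t - s) `^ alpha) * G s) =
    \int[mu]_s (mittag_leffler_kernel alpha (- lambda) (t - s) * (G \_ `[0, T]) s).
  apply: Rintegral_itv_eq => // [s s0|s ts|s /andP[s0 st]].
  - by rewrite G0// mulr0.
  - by rewrite /mittag_leffler_kernel subr_gt0 ltNge ts mul0r.
  rewrite /mittag_leffler_kernel subr_gt0 st patchE mem_set//=.
  by rewrite in_itv/= ltW//= (le_trans (ltW st)).
have Scvg := @mittag_leffler_kernel_cvg R alpha (- lambda) t alpha_gt0.
rewrite {1}/mittag_leffler_kernel t0 in Scvg.
(* The remainder is at most the L^1 norm of [g] times a term of a convergent Mittag-Leffler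
   series. *)
have remainder : (- lambda) ^+ n * frac_integral (alpha * n%:R + 1) g t
    @[n --> \oo] --> 0.
  have a1 n : 1 <= alpha * n%:R + 1 by rewrite lerDr mulr_ge0// ltW.
  pose M := \int[mu]_s `|g s|.
  have r0 : 0 <= `|- lambda| * t `^ alpha by rewrite mulr_ge0// powR_ge0.
  have u0 : mittag_leffler_term alpha (`|- lambda| * t `^ alpha) n * M
      @[n --> \oo] --> 0.
    rewrite -[X in _ --> X](mul0r M); apply: cvgMl.
    exact: cvg_series_cvg_0 (mittag_leffler_cvg_ge0 alpha_gt0 r0).
  apply/norm_cvg0P; apply: (squeeze_cvgr _ (cvg_cst 0) u0).
  apply: nearW => n; rewrite normr_ge0/= normrM normrX mittag_leffler_termE//.
  by rewrite -mulrA ler_wpM2l ?exprn_ge0// frac_integral_norm_le.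
have lim : series (fun k => (- lambda) ^+ k *
      frac_integral (alpha * k%:R + 1) (G \_ `[0, T]) t) @ \oo -->
    (1 - alpha) / B alpha *
      (f t - 0 - f 0 * mittag_leffler alpha (- lambda * t `^ alpha)).
  under eq_cvg => n do rewrite series_telescope//.
  apply: cvgMr; apply: cvgB; first by apply: cvgB => //; exact: cvg_cst.
  by apply: cvgMr; rewrite cvg_shiftS.
(* The same partial sums converge by dominated convergence and by telescoping; equating the limits
   leaves the factor [B alpha / (1 - alpha)] to cancel [c]. *)
rewrite (cvg_unique _ Fcvg lim)//.
have d0 : 1 - alpha != 0 by rewrite subr_eq0 gt_eqF.
by field; rewrite d0 B_neq0.
Qed.

End AtanganaBaleanu.

Theorem proposition3p2 (R : realType) (T alpha : R) (B f : R -> R)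
    (T_gt0 : 0 < T) (alpha_gt0 : 0 < alpha) (alpha_lt1 : alpha < 1)
    (B0 : B 0 = 1) (B1 : B 1 = 1) (B_neq0 : B alpha != 0)
    (f_AC : abs_continuous T f) :
  abs_continuous T (AB_integral B alpha f) /\
  forall t : R, 0 < t <= T ->
    ABC_derivative T B alpha (AB_integral B alpha f) t
    = f t - mittag_leffler alpha (- (alpha / (1 - alpha)) * t `^ alpha) * f 0.
Proof.
have [g /L1_derivative_extension[ig g_lt0 fE]] := f_AC.
split; first exact: (AB_integral_abs_continuous alpha_gt0
    alpha_lt1 B_neq0 ig g_lt0 fE (ltW T_gt0)).
by move=> t; exact: (ABC_derivative_AB_integral alpha_gt0
  alpha_lt1 B_neq0 ig g_lt0 fE).
Qed.
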